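(* Let $V=V_{-1}\oplus V_0\oplus V_1$ with $V_{-1}=\langle u\rangle$, $V_0=\langle v\rangle$, $V_1=\langle w\rangle$ one-dimensional, equipped with the skew symmetric linear operators $l_n:V^{\otimes n}\to V$ of degree $2-n$ ($n\ge1$) given by constants $a_n,b_n,c_n$ via $$l_n(u\otimes v\otimes w^{\otimes n-2})=a_n u\ (n\ge2),\qquad l_n(u\otimes w^{\otimes n-1})=b_n v\ (n\ge1),\qquad l_n(v\otimes w^{\otimes n-1})=c_n w\ (n\ge1),$$ and $a_1:=0$. Let $m\ge1$. Then $V$ is $L_m$ if and only if one of the following holds: (i) $b_p=0$ for all $p\le m$; or (ii) there exists $k\in\mathbb N$ such that $1\le k\le m$, $b_p=0$ for all $p<k$, $b_k\ne0$, and $a_q=c_q=0$ for all $q\le m-k+1$.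
   Context: All vector spaces are graded, over a fixed field of characteristic zero; $|x|$ is the degree of $x$. For a permutation $\sigma$ of a string of homogeneous elements, $\varepsilon(\sigma)$ is the Koszul sign (a factor $(-1)^{pq}$ whenever elements of degrees $p$ and $q$ are commuted) and $\chi(\sigma)=(-1)^{\sigma}\varepsilon(\sigma)$, where $(-1)^\sigma$ is the sign of $\sigma$. A $(p,n-p)$ unshuffle is $\sigma\in S_n$ with $\sigma(1)<\dots<\sigma(p)$ and $\sigma(p+1)<\dots<\sigma(n)$. A linear map $l:V^{\otimes n}\to V$ has degree $k$ if $l(x_1\otimes\dots\otimes x_n)\in V_N$ with $N=k+\sum|x_i|$; it is skew symmetric if $l(x_{\pi(1)}\otimes\dots\otimes x_{\pi(n)})=\chi(\pi)\,l(x_1\otimes\dots\otimes x_n)$ for all $\pi\in S_n$. Given skew symmetric maps $l_k$, define $\mathcal J_n:V^{\otimes n}\to V$ by $$\mathcal J_n(x_1\otimes\dots\otimes x_n)=\sum_{p=1}^n(-1)^{p(n-p)}\sum_{\sigma\ (p,n-p)\text{ unshuffle}}\chi(\sigma)\,l_{n-p+1}\big(l_p(x_{\sigma(1)}\otimes\dots\otimes x_{\sigma(p)})\otimes x_{\sigma(p+1)}\otimes\dots\otimes x_{\sigma(n)}\big).$$ $V$ is $L_m$ (has an $L_m$ structure) if the maps $l_k$, $1\le k\le m$, are skew symmetric, linear, of degree $2-k$, and $\mathcal J_n=0$ for all $1\le n\le m$. In the claim, $u,v,w$ have degrees $-1,0,1$, and all other graded components of $V$ are zero. The values of $l_n$ on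 permutations of the listed tensors are determined by skew symmetry; $l_n$ vanishes on all other tensors of basis vectors. Indices of $a,b,c$ are positive integers. *)

(* Defs.v *)
From HB Require Import structures.
From mathcomp Require Import all_boot all_order all_algebra all_fingroup.

Set Implicit Arguments.
Unset Strict Implicit.
Unset Printing Implicit Defensive.

Import GRing.Theory.
Local Open Scope ring_scope.

(* V is the internal direct sum of the subspaces gr i, i : int. *)
Record is_grading (K : fieldType) (V : lmodType K) (gr : int -> {pred V}) :
    Prop := IsGrading {
  grading_submod : forall i, submod_closed (gr i);
  grading_span : forall x : V, exists (s : seq int) (f : int -> V),
    (forall i, f i \in gr i) /\ x = \sum_(i <- s) f i;
  grading_direct : forall (s : seq int) (f : int -> V),
    uniq s -> (forall i, f i \in gr i) -> \sum_(i <- s) f i = 0 ->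
    forall i, i \in s -> f i = 0
}.

Definition homogeneous (K : fieldType) (V : lmodType K)
    (gr : int -> {pred V}) (n : nat) (d : n.-tuple int) (x : n.-tuple V) :
    Prop :=
  forall i, tnth x i \in gr (tnth d i).

Definition permute (T : Type) (n : nat) (s : 'S_n) (x : n.-tuple T) :
    n.-tuple T :=
  [tuple tnth x (s i) | i < n].

(* In passing from x_1 ... x_n to x_s(1) ... x_s(n), the pairs of elements
   that are commuted are those indexed by the inversions of s. *)
Definition koszul_sign (K : fieldType) (n : nat) (d : n.-tuple int)
    (s : 'S_n) : K :=
  \prod_(i < n) \prod_(j < n | (i < j)%N && (s j < s i)%N)
    (-1) ^ (tnth d (s i) * tnth d (s j)).

Definition chi (K : fieldType) (n : nat) (d : n.-tuple int) (s : 'S_n) : K :=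
  (-1) ^+ odd_perm s * koszul_sign K d s.

Definition unshuffle (n p : nat) (s : 'S_n) : bool :=
  [forall i : 'I_n, forall j : 'I_n,
    [&& (i < j)%N & (j < p)%N || (p <= i)%N] ==> (s i < s j)%N].

(* Linear maps out of the n-th tensor power of V are represented by
   multilinear maps on n.-tuple V. *)
Definition set_tnth (T : Type) (n : nat) (x : n.-tuple T) (i : 'I_n) (y : T) :
    n.-tuple T :=
  [tuple if j == i then y else tnth x j | j < n].

Definition multilinear (K : fieldType) (V : lmodType K) (n : nat)
    (f : n.-tuple V -> V) : Prop :=
  forall (x : n.-tuple V) (i : 'I_n), linear (fun y => f (set_tnth x i y)).

Definition has_degree (K : fieldType) (V : lmodType K) (gr : int -> {pred V})
    (n : nat) (k : int) (f : n.-tuple V -> V) : Prop :=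
  forall (d : n.-tuple int) (x : n.-tuple V), homogeneous gr d x ->
    f x \in gr (k + \sum_(i < n) tnth d i).

Definition skew_symmetric (K : fieldType) (V : lmodType K)
    (gr : int -> {pred V}) (n : nat) (f : n.-tuple V -> V) : Prop :=
  forall (s : 'S_n) (d : n.-tuple int) (x : n.-tuple V),
    homogeneous gr d x -> f (permute s x) = chi K d s *: f x.

(* The index p : 'I_n stands for the arity p.+1, which ranges over 1, ..., n;
   the two blocks of 'I_n below have p.+1 and n - p.+1 elements. *)
Definition fst_block (n : nat) (p : 'I_n) (i : 'I_p.+1) : 'I_n :=
  widen_ord (ltn_ord p) i.

Definition snd_block (n : nat) (p : 'I_n) (j : 'I_(n - p.+1)) : 'I_n :=
  cast_ord (subnKC (ltn_ord p)) (rshift p.+1 j).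

(* J_n on a tensor of homogeneous vectors x of degrees d. *)
Definition jacobi (K : fieldType) (V : lmodType K)
    (l : forall n, n.-tuple V -> V) (n : nat) (d : n.-tuple int)
    (x : n.-tuple V) : V :=
  \sum_(p < n) (-1) ^+ (p.+1 * (n - p.+1))%N *:
    \sum_(s : 'S_n | unshuffle p.+1 s) chi K d s *:
      l (n - p.+1).+1
        [tuple of l p.+1 [tuple tnth x (s (fst_block i)) | i < p.+1]
               :: [tuple tnth x (s (snd_block j)) | j < n - p.+1]].

Definition L_structure (K : fieldType) (V : lmodType K)
    (gr : int -> {pred V}) (l : forall n, n.-tuple V -> V) (m : nat) : Prop :=
  (forall k, (1 <= k <= m)%N ->
     [/\ multilinear (l k), skew_symmetric gr (l k)
       & has_degree gr (2 - k%:Z) (l k)]) /\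
  (forall n, (1 <= n <= m)%N ->
     forall (d : n.-tuple int) (x : n.-tuple V),
       homogeneous gr d x -> jacobi l d x = 0).

(* Main.v *)
Require Import Defs.
From HB Require Import structures.
From mathcomp Require Import all_boot all_order all_algebra all_fingroup.
From mathcomp Require Import zify.

(** The entries u and w are odd and commute inside an operation without sign,
    while v is even and anticommutes with everything. So an operation can be
    nonzero only on tensors with at most one v: with one v it is governed by the
    constants a, c and its value is odd, and with none it is governed by b and
    its value is a multiple of v.

    Consider one summand l_q (l_p (...) ...) of the Jacobi expression, where
    p + q = n + 1. On a tensor with at most one v, the parities just described
    force one of the two operations to be governed by b and the other one by a
    or c ([nest_eq0]); hence all summands vanish as soon as b_p = 0 or
    a_q = c_q = 0 whenever p + q = n + 1, which both (i) and (ii) guarantee for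
    n <= m. On a tensor with more than one v the summands need not vanish one by one,
    but the whole Jacobi expression is skew symmetric ([jacobi_permute]) and
    exchanging two v's changes its sign, so that it is zero
    ([jacobi_repeat]). Linearity reduces arbitrary homogeneous arguments to
    basis vectors ([jacobi_eq0]).

    Conversely, let k be the least index with b_k <> 0, and argue by induction
    on q that a_q = c_q = 0 as long as n = k + q - 1 is at most m. Evaluate J_n
    on u, w, ..., w followed by an odd tensor t of length q - 1, the first part
    having length k. The summands with p < k contain b_p = 0, and those with
    p > k contain an a or c that is already known to vanish. The summands with
    p = k are each zero or b_k l_q (v t) up to a common sign, because every chi
    is 1 on odd entries; in characteristic zero they cannot cancel, and
    l_q (v t) = 0 ([jacobi_leading_term]). The choices t = w, ..., w and t = u, w, ..., w give
    c_q = 0 and a_q = 0 ([ac_eq0]).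

    Skew symmetry of the Jacobi expression rests on two facts. The sign chi is
    a product over inversions and so obeys a cocycle rule ([chiM]). The
    unshuffles represent the cosets of the permutations that preserve both
    blocks, and the summands are constant on each coset by skew symmetry of the
    operations; a sum over unshuffles is thus, up to a positive integer factor,
    a sum over the whole symmetric group ([sum_unshuffle]). *)

Set Implicit Arguments.
Unset Strict Implicit.
Unset Printing Implicit Defensive.

Import GRing.Theory.
Local Open Scope ring_scope.

(** * Inversions and the sign chi *)

Section InversionProducts.

Variables (K : fieldType) (n : nat).
Implicit Types (e : 'I_n -> 'I_n -> K) (s t : 'S_n).

Definition inversion_prod e s : K :=
  \prod_(q : 'I_n * 'I_n | (q.1 < q.2)%N && (s q.2 < s q.1)%N)
    e (s q.1) (s q.2).

(** A symmetric factor attached to each pair of positions may be attached to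
    the pair of their images instead: both products run over all unordered
    pairs. *)
Lemma reindex_pairs e s : (forall i j, e i j = e j i) ->
  \prod_(q : 'I_n * 'I_n | (q.1 < q.2)%N) e q.1 q.2
  = \prod_(q : 'I_n * 'I_n | (q.1 < q.2)%N) e (s q.1) (s q.2).
Proof.
move=> esym.
pose srt (r : 'S_n) (q : 'I_n * 'I_n) :=
  if (r q.1 < r q.2)%N then (r q.1, r q.2) else (r q.2, r q.1).
have srtK r (q : 'I_n * 'I_n) : (q.1 < q.2)%N -> srt r (srt r^-1%g q) = q.
  case: q => i j /= lt_ij; rewrite /srt /=.
  by case lt_r: (r^-1%g i < r^-1%g j)%N; rewrite /= !permKV ?lt_ij // ltnNge ltnW.
have srt_lt (r : 'S_n) (q : 'I_n * 'I_n) : (q.1 < q.2)%N -> ((srt r q).1 < (srt r q).2)%N.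
  case: q => i j /= lt_ij; rewrite /srt /=; case: ifP => // /negbT.
  rewrite -leqNgt leq_eqVlt => /orP[/eqP/val_inj/perm_inj eq_ij|//].
  by rewrite eq_ij ltnn in lt_ij.
rewrite (reindex_onto (srt s) (srt s^-1%g)) /=; last exact: srtK.
apply: eq_big => [q|[i j] _] /=; last first.
  by rewrite /srt /=; case: ifP => _ //=; rewrite esym.
apply/andP/idP => [[lt_sq /eqP <-]|lt_q]; first exact: srt_lt.
by rewrite srt_lt //; split=> //; have := srtK s^-1%g q lt_q; rewrite invgK => ->.
Qed.

(** A pair of positions is an inversion of the composite iff it is one of
    exactly one of the two factors; as e squares to one, the pairs inverted
    twice drop out. *)
Lemma inversion_prodM e s t :
    (forall i j, e i j = e j i) -> (forall i j, e i j * e i j = 1) ->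
  inversion_prod e (s * t)
  = inversion_prod e t * inversion_prod (fun i j => e (t i) (t j)) s.
Proof.
move=> esym e2.
have invE f r : inversion_prod f r = \prod_(q : 'I_n * 'I_n | (q.1 < q.2)%N)
    if (q.1 < q.2)%N (+) (r q.1 < r q.2)%N then f (r q.1) (r q.2) else 1.
  rewrite /inversion_prod big_mkcondr /=; apply: eq_bigr => -[i j] /= lt_ij.
  rewrite lt_ij addTb; case: (ltngtP (r i) (r j)) => //= /ord_inj/perm_inj e_ij.
  by rewrite e_ij ltnn in lt_ij.
rewrite !invE; rewrite [in X in X * _](@reindex_pairs
    (fun i j => if (i < j)%N (+) (t i < t j)%N then e (t i) (t j) else 1) s)
    => [|i j]; last first.
  have [-> //|nij] := eqVneq i j; rewrite esym.
  have: t i != t j by rewrite (inj_eq perm_inj).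
  move: nij; rewrite -!val_eqE /=.
  by case: (ltngtP i j) => // _ _; case: (ltngtP (t i) (t j)).
rewrite -big_split /=; apply: eq_bigr => -[i j] /= lt_ij.
rewrite !permM lt_ij !addTb.
by case: (s i < s j)%N; case: (t (s i) < t (s j))%N; rewrite /= ?mul1r ?mulr1 ?e2.
Qed.

(** By the previous lemma the product is multiplicative in s; all transpositions
    are conjugate, hence have the value of the one that exchanges the first two
    positions and has a single inversion. *)
Lemma inversion_prod_sign s : inversion_prod (fun _ _ => -1) s = (-1) ^+ odd_perm s.
Proof.
set N := inversion_prod _.
have NM r t : N (r * t)%g = N r * N t.
  by rewrite /N inversion_prodM 1?mulrC // => i j; rewrite mulrNN mulr1.
have N1 : N 1%g = 1.
  by rewrite /N /inversion_prod big_pred0 // => -[i j] /=; rewrite !perm1; case: ltngtP.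
have Nt (i j : 'I_n) : i != j -> N (tperm i j) = -1.
  have n_gt1 : i != j -> (1 < n)%N.
    by case: n i j => [[]|[|//]] // i j; rewrite !ord1 eqxx.
  move=> nij; move/n_gt1: (nij) => n1.
  pose o0 := Ordinal (ltnW n1); pose o1 := Ordinal n1.
  have [r r0 r1] : exists2 r : 'S_n, r o0 = i & r o1 = j.
    exists (tperm o0 i * tperm (tperm o0 i o1) j)%g; last by rewrite permM tpermL.
    rewrite permM tpermL [LHS]tpermD //; last by rewrite eq_sym.
    by rewrite -[X in _ == X](tpermL o0 i) (inj_eq perm_inj).
  have <- : (tperm o0 o1 ^ r)%g = tperm i j by rewrite tpermJ r0 r1.
  rewrite conjgE !NM mulrCA -NM mulVg N1 mulr1.
  rewrite /N /inversion_prod (big_pred1 (o0, o1)) // => -[x y] /=.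
  rewrite xpair_eqE.
  case: (tpermP o0 o1 x) => [->|->|/eqP x0 /eqP x1];
    case: (tpermP o0 o1 y) => [->|->|/eqP y0 /eqP y1] //=.
  - by rewrite (negbTE y1); case: (y : nat) => [|[]].
  - by rewrite ltn0 andbF.
  - by rewrite andbC.
  - by rewrite (negbTE x0); case: (x : nat) => [|[]].
  - by rewrite (negbTE x0); case: ltngtP.
have [ts -> ts_pair] := prod_tpermP s.
rewrite odd_perm_prod // signr_odd.
elim: ts ts_pair => [|[i j] ts IH] /= => [_|/andP[dij /IH {}IH]]; first by rewrite big_nil.
by rewrite big_cons NM IH Nt // exprS.
Qed.

End InversionProducts.

Section Chi.

Variable K : fieldType.

(** The permutation sign and the Koszul sign of one exchange, combined. *)
Definition swap_sign n (d : n.-tuple int) (i j : 'I_n) : K :=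
  - (-1) ^ (tnth d i * tnth d j).

Lemma swap_signC n (d : n.-tuple int) i j : swap_sign d i j = swap_sign d j i.
Proof. by rewrite /swap_sign mulrC. Qed.

Lemma swap_sign_sq n (d : n.-tuple int) i j : swap_sign d i j * swap_sign d i j = 1.
Proof. by rewrite /swap_sign mulrNN -expfzMl mulrNN mulr1 exp1rz. Qed.

(** The parity of a permutation is that of its number of inversions, so both
    factors of chi are products over inversions. *)
Lemma chi_inversions n (d : n.-tuple int) s :
  chi K d s = inversion_prod (swap_sign d) s.
Proof.
rewrite /chi -inversion_prod_sign /koszul_sign pair_big_dep /= -big_split /=.
by apply: eq_bigr => q _; rewrite /swap_sign mulN1r.
Qed.

Lemma permuteM (T : Type) n (s t : 'S_n) (x : n.-tuple T) :
  permute s (permute t x) = permute (s * t)%g x.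
Proof. by apply: eq_from_tnth => i; rewrite !tnth_mktuple permM. Qed.

Lemma permute1 (T : Type) n (x : n.-tuple T) : permute 1%g x = x.
Proof. by apply: eq_from_tnth => i; rewrite !tnth_mktuple perm1. Qed.

Lemma chiM n (d : n.-tuple int) (s t : 'S_n) :
  chi K d (s * t)%g = chi K d t * chi K (permute t d) s.
Proof.
rewrite !chi_inversions inversion_prodM => [||i j]; [|exact: swap_signC|exact: swap_sign_sq].
by congr (_ * _); apply: eq_bigr => q _; rewrite /swap_sign !tnth_mktuple.
Qed.

Lemma chi_sq n (d : n.-tuple int) s : chi K d s * chi K d s = 1.
Proof.
rewrite chi_inversions -big_split /= big1 // => q _; exact: swap_sign_sq.
Qed.

Lemma chi_neq0 n (d : n.-tuple int) s : chi K d s != 0.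
Proof.
by apply/eqP=> chi0; have /eqP := chi_sq d s; rewrite chi0 mul0r eq_sym oner_eq0.
Qed.

Lemma sign_odd (z : int) : odd `|z| -> (-1) ^ z = -1 :> K.
Proof.
case: z => m; first by rewrite -exprnP -signr_odd => ->.
by rewrite NegzE abszN -exprnN -signr_odd => ->; rewrite expr1 invrN1.
Qed.

(** Odd entries commute without sign: the sign of the permutation and the
    Koszul sign cancel. *)
Lemma chi_odd n (d : n.-tuple int) s :
  (forall i, odd `|tnth d i|) -> chi K d s = 1.
Proof.
move=> odd_d; rewrite chi_inversions /inversion_prod big1 // => q _.
by rewrite /swap_sign sign_odd ?opprK // abszM oddM !odd_d.
Qed.

Lemma chi_tperm n (d : n.-tuple int) (i j : 'I_n) :
  i != j -> tnth d i = 0 -> tnth d j = 0 -> chi K d (tperm i j) = -1.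
Proof.
move=> nij di dj; rewrite /chi odd_tperm nij expr1 /koszul_sign.
rewrite big1 ?mulr1 // => x _; rewrite big1 // => y /andP[lt_xy].
by do 2![case: tpermP => [_|_|_ _]]; rewrite ?di ?dj ?mul0r ?mulr0 ?expr0z //
   => /(ltn_trans lt_xy); rewrite ltnn.
Qed.

End Chi.

(** * Unshuffles as coset representatives *)

Section Unshuffles.

Variables (n p : nat).
Implicit Types (h r s : 'S_n).

Definition block_stab : {set 'S_n} :=
  [set h : 'S_n | [forall i, (h i < p)%N == (i < p)%N]].

Lemma block_stabP h :
  reflect (forall i, (h i < p)%N = (i < p)%N) (h \in block_stab).
Proof. by rewrite inE; apply: eqfunP. Qed.

Lemma block_stab1 : 1%g \in block_stab.
Proof. by apply/block_stabP=> i; rewrite perm1. Qed.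

Lemma block_stabM h r :
  h \in block_stab -> r \in block_stab -> (h * r)%g \in block_stab.
Proof. by move=> /block_stabP hH /block_stabP rH; apply/block_stabP=> i; rewrite permM rH. Qed.

Lemma block_stabV h : h \in block_stab -> h^-1%g \in block_stab.
Proof. by move=> /block_stabP hH; apply/block_stabP=> i; rewrite -hH permKV. Qed.

Lemma increasing_perm1 h : (forall i j : 'I_n, (i < j)%N -> (h i < h j)%N) -> h = 1%g.
Proof.
have ge_id r : (forall i j : 'I_n, (i < j)%N -> (r i < r j)%N) ->
    forall i : 'I_n, (i <= r i)%N.
  move=> incr_r [k lt_kn]; elim: k lt_kn => [|k IHk] lt_kn //=.
  have lt_r := incr_r (Ordinal (ltnW lt_kn)) (Ordinal lt_kn) (ltnSn k).
  by apply: leq_trans lt_r; apply: IHk.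
move=> incr_h; apply/permP=> i; apply: ord_inj; rewrite perm1; apply/eqP.
rewrite eqn_leq ge_id // andbT leqNgt; apply/negP=> lt_hi.
have {}lt_hi := incr_h _ _ lt_hi.
have incr_hV (j k : 'I_n) : (j < k)%N -> (h^-1%g j < h^-1%g k)%N.
  case: (ltngtP (h^-1%g j) (h^-1%g k)) => // [/incr_h|/ord_inj/perm_inj-> //].
    by rewrite !permKV => /ltn_trans le_kj /le_kj; rewrite ltnn.
  by rewrite ltnn.
by have := ge_id _ incr_hV (h (h i)); rewrite permK leqNgt lt_hi.
Qed.

(** In each coset of the block stabiliser, the element that maximises
    the sum of the i * r i is sorted on both blocks, by the rearrangement
    inequality; two sorted elements differ by an increasing permutation. *)
Lemma unshuffle_coset s :
  exists r, forall r',
    unshuffle p r' && ((s * r'^-1)%g \in block_stab) = (r' == r).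
Proof.
have Ps : (s * s^-1)%g \in block_stab by rewrite mulgV block_stab1.
pose weight r : nat := (\sum_(i < n) i * r i)%N.
case: (@arg_maxnP _ s (fun r => (s * r^-1)%g \in block_stab) weight Ps) => r Pr max_r.
have Ur : unshuffle p r.
  apply/forallP=> i; apply/forallP=> j; apply/implyP=> /andP[lt_ij same].
  rewrite ltnNge leq_eqVlt; apply/negP=> /orP[/eqP/ord_inj/perm_inj eji|lt_r].
    by rewrite eji ltnn in lt_ij.
  have tH : tperm i j \in block_stab.
    apply/block_stabP=> k; case: tpermP => [->|->|//].
      by case/orP: same => [lt_jp|le_pi]; lia.
    by case/orP: same => [lt_jp|le_pi]; lia.
  have nji : j != i by rewrite -val_eqE /=; lia.
  (* Exchanging the values at i and j would increase the weight. *)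
  have weightE t : weight t = (i * t i + (j * t j
      + \sum_(k < n | (k != i) && (k != j)) k * t k))%N.
    by rewrite /weight (bigD1 i) // (bigD1 j).
  have := max_r (tperm i j * r)%g; rewrite invMg tpermV mulgA block_stabM // => /(_ isT).
  rewrite /= !weightE !permM tpermL tpermR.
  under eq_bigr => k /andP[ki kj] do rewrite permM tpermD 1?eq_sym //.
  by set R := (\sum_(_ < n | _) _)%N; nia.
exists r => r'; apply/andP/eqP=> [[Ur' Pr']|-> //].
suff : (r' * r^-1)%g = 1%g by move/(canRL (mulgKV _)); rewrite mul1g.
have hH : (r' * r^-1)%g \in block_stab.
  have -> : (r' * r^-1 = (s * r'^-1)^-1 * (s * r^-1))%g.
    by rewrite invMg invgK mulgA mulgKV.
  by rewrite block_stabM ?block_stabV.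
set h := (r' * r^-1)%g in hH *; have r'E i : r' i = r (h i).
  by rewrite /h permM permKV.
move/block_stabP: hH => hH; apply: increasing_perm1 => i j lt_ij.
have lt_same : ((j < p) || (p <= i))%N -> (h i < h j)%N.
  move=> same; have lt_r' : (r' i < r' j)%N.
    by have /forallP/(_ i)/forallP/(_ j) := Ur'; rewrite lt_ij same.
  rewrite ltnNge leq_eqVlt; apply/negP=> /orP[/eqP/ord_inj/perm_inj eji|lt_h].
    by rewrite eji ltnn in lt_ij.
  have /forallP/(_ (h j))/forallP/(_ (h i)) := Ur.
  rewrite lt_h !r'E in lt_r' *; rewrite hH [in (p <= _)%N]leqNgt hH -leqNgt.
  have -> /= : (i < p)%N || (p <= j)%N.
    by case/orP: same => [/(ltn_trans lt_ij)->|le_pi] //; rewrite (leq_trans le_pi) ?orbT // ltnW.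
  by move/(ltn_trans lt_r'); rewrite ltnn.
(* The remaining case, i and j in different blocks, holds as h preserves both. *)
have [lt_jp|le_pj] := ltnP j p; first by rewrite lt_same ?lt_jp.
have [lt_ip|le_pi] := ltnP i p; last by rewrite lt_same ?le_pi ?orbT.
by rewrite (@leq_trans p) ?hH // leqNgt hH -leqNgt.
Qed.

(** An unshuffle sum of a summand that is invariant under the block stabiliser
    is a multiple of a sum over the whole symmetric group, where substitutions
    are easy. *)
Lemma sum_unshuffle (V : nmodType) (F : 'S_n -> V) :
    (forall h s, h \in block_stab -> F (h * s)%g = F s) ->
  \sum_s F s = (\sum_(s | unshuffle p s) F s) *+ #|block_stab|.
Proof.
move=> F_inv; rewrite -sumrMnl.
transitivity (\sum_(r | unshuffle p r) \sum_(s | (s * r^-1)%g \in block_stab) F s).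
  rewrite (exchange_big_dep xpredT) //=; apply: eq_bigr => s _.
  by have [r rP] := unshuffle_coset s; rewrite (big_pred1 r).
apply: eq_bigr => r _; rewrite -sumr_const (reindex_inj (mulIg r)) /=.
by apply: eq_big => [s|s]; rewrite mulgK // => /F_inv->.
Qed.

End Unshuffles.

(** * Blocks of a tuple *)

Section Blocks.

Lemma fst_block_lt n (p : 'I_n) (i : 'I_p.+1) : (fst_block i < p.+1)%N.
Proof. exact: (ltn_ord i). Qed.

Lemma snd_block_ge n (p : 'I_n) (j : 'I_(n - p.+1)) : (p.+1 <= snd_block j)%N.
Proof. exact: leq_addr. Qed.

Lemma fst_block_inj n (p : 'I_n) : injective (@fst_block n p).
Proof. by move=> i j /(congr1 val) eq_ij; apply: ord_inj. Qed.

Lemma snd_block_inj n (p : 'I_n) : injective (@snd_block n p).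
Proof. by move=> i j /(congr1 val)/addnI eq_ij; apply: ord_inj. Qed.

Lemma big_blocks (R : Type) (idx : R) (op : Monoid.com_law idx) n (p : 'I_n)
    (F : 'I_n -> R) :
  \big[op/idx]_(i < n) F i =
    op (\big[op/idx]_(i < p.+1) F (fst_block i))
       (\big[op/idx]_(j < n - p.+1) F (snd_block j)).
Proof.
pose c := cast_ord (subnKC (ltn_ord p)).
have c_bij : bijective c by exists (cast_ord (esym (subnKC (ltn_ord p)))) => i; apply: ord_inj.
rewrite (reindex c) /=; last exact: onW_bij.
rewrite big_split_ord; congr (op _ _).
by apply: eq_bigr => i _; congr F; apply: ord_inj.
Qed.

Definition block1 T n (p : 'I_n) (x : n.-tuple T) : p.+1.-tuple T :=
  [tuple tnth x (fst_block i) | i < p.+1].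

Definition block2 T n (p : 'I_n) (x : n.-tuple T) : (n - p.+1).-tuple T :=
  [tuple tnth x (snd_block j) | j < n - p.+1].

(** A permutation that preserves the image of an injection restricts to it. *)
Lemma perm_restrict (T1 T2 : finType) (f : T1 -> T2) (h : {perm T2}) :
    injective f -> (forall i, h (f i) \in codom f) ->
  exists h1 : {perm T1}, forall i, h (f i) = f (h1 i).
Proof.
move=> f_inj hf; have h1_inj : injective (fun i => iinv (hf i)).
  move=> i j /(congr1 f); rewrite !f_iinv => /perm_inj; exact: f_inj.
by exists (perm h1_inj) => i; rewrite permE f_iinv.
Qed.

Lemma codom_fst_block n (p : 'I_n) (i : 'I_n) :
  (i \in codom (@fst_block n p)) = (i < p.+1)%N.
Proof.
apply/codomP/idP => [[j ->]|lt_ip]; first exact: fst_block_lt.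
by exists (Ordinal lt_ip); apply: ord_inj.
Qed.

Lemma codom_snd_block n (p : 'I_n) (i : 'I_n) :
  (i \in codom (@snd_block n p)) = (p.+1 <= i)%N.
Proof.
apply/codomP/idP => [[j ->]|le_pi]; first exact: snd_block_ge.
have lt_i : (i - p.+1 < n - p.+1)%N by rewrite ltn_sub2r // (leq_ltn_trans le_pi).
by exists (Ordinal lt_i); apply: ord_inj; rewrite /= subnKC.
Qed.

Variable K : fieldType.

(** Positions split into two intervals, in terms of order embeddings f1 and f2;
    a permutation that preserves both has no inversion across them. *)
Lemma chi_split n q1 q2 (f1 : 'I_q1 -> 'I_n) (f2 : 'I_q2 -> 'I_n)
    (h : 'S_n) (h1 : 'S_q1) (h2 : 'S_q2)
    (d : n.-tuple int) (d1 : q1.-tuple int) (d2 : q2.-tuple int) :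
    (forall F : 'I_n -> K, \prod_i F i = (\prod_i F (f1 i)) * (\prod_j F (f2 j))) ->
    (forall i j, (f1 i < f1 j)%N = (i < j)%N) ->
    (forall i j, (f2 i < f2 j)%N = (i < j)%N) ->
    (forall i j, (f1 i < f2 j)%N) ->
    (forall i, h (f1 i) = f1 (h1 i)) -> (forall j, h (f2 j) = f2 (h2 j)) ->
    (forall i, tnth d1 i = tnth d (f1 i)) -> (forall j, tnth d2 j = tnth d (f2 j)) ->
  chi K d h = chi K d1 h1 * chi K d2 h2.
Proof.
move=> F12 f1lt f2lt f12 hf1 hf2 d1E d2E.
have invE m e (s : 'S_m) : inversion_prod e s =
    \prod_(i < m) \prod_(j < m) (if (i < j)%N && (s j < s i)%N then e (s i) (s j) else 1) :> K.
  by rewrite pair_big /= -big_mkcond.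
have f21 j i : (f2 j < f1 i)%N = false by apply/negbTE; rewrite -leqNgt ltnW.
rewrite !chi_inversions !invE F12; congr (_ * _); apply: eq_bigr => i _; rewrite F12.
  rewrite [X in _ * X]big1 ?mulr1 => [|j _]; last by rewrite hf1 hf2 f21 andbF.
  by apply: eq_bigr => j _; rewrite !hf1 !f1lt /swap_sign !d1E.
rewrite [X in X * _]big1 ?mul1r => [|j _]; last by rewrite f21.
by apply: eq_bigr => j _; rewrite !hf2 !f2lt /swap_sign !d2E.
Qed.

(** Fixing a first entry is the case of a first interval of length one. *)
Lemma chi_cons n (d0 : int) (d : n.-tuple int) (s : 'S_n) :
  chi K [tuple of d0 :: d] (lift_perm ord0 ord0 s) = chi K d s.
Proof.
rewrite (@chi_split _ 1 n (fun=> ord0) (lift ord0) _ 1%g s _ [tuple d0] d) //.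
- rewrite [X in X * _](_ : _ = 1) ?mul1r // chi_inversions /inversion_prod.
  by rewrite big_pred0 // => -[i j] /=; rewrite !ord1.
- by move=> F; rewrite big_ord_recl big_ord1.
- by move=> i j; rewrite !ord1 !ltnn.
- by move=> i; rewrite lift_perm_id.
- by move=> j; rewrite lift_perm_lift.
- by move=> i; rewrite ord1.
- by move=> j; rewrite tnthS.
Qed.

Lemma chi_blocks n (p : 'I_n) (d : n.-tuple int) (h : 'S_n)
    (h1 : 'S_p.+1) (h2 : 'S_(n - p.+1)) :
    (forall i, h (fst_block i) = fst_block (h1 i)) ->
    (forall j, h (snd_block j) = snd_block (h2 j)) ->
  chi K d h = chi K (block1 p d) h1 * chi K (block2 p d) h2.
Proof.
move=> hE1 hE2; apply: (chi_split _ _ _ _ hE1 hE2) => *.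
- exact: big_blocks.
- by [].
- by rewrite /= ltn_add2l.
- exact: leq_trans (fst_block_lt _) (snd_block_ge _).
- by rewrite tnth_mktuple.
- by rewrite tnth_mktuple.
Qed.

End Blocks.

(** * The Jacobi expression is skew symmetric *)

Section Multilinear.

Variables (K : fieldType) (V : lmodType K).

Lemma scaler_swap (a b : K) (v : V) : a *: (b *: v) = b *: (a *: v).
Proof. by rewrite !scalerA mulrC. Qed.

Lemma multilinear_set0 n (f : n.-tuple V -> V) x i :
  multilinear f -> f (set_tnth x i 0) = 0.
Proof.
move=> /(_ x i) /(_ 1 0 0) /=; rewrite !scale1r addr0 => /eqP.
by rewrite -subr_eq subrr => /eqP/esym.
Qed.

Lemma multilinear_setZ n (f : n.-tuple V -> V) x i a y :
  multilinear f -> f (set_tnth x i (a *: y)) = a *: f (set_tnth x i y).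
Proof.
by move=> f_lin; have /= := f_lin x i a y 0; rewrite multilinear_set0 // !addr0.
Qed.

Lemma multilinear_scale n (f : n.-tuple V -> V) (k : 'I_n -> K) (x : n.-tuple V) :
    multilinear f ->
  f [tuple k i *: tnth x i | i < n] = (\prod_i k i) *: f x.
Proof.
move=> f_lin.
suff H r : uniq r -> f [tuple if i \in r then k i *: tnth x i else tnth x i | i < n]
    = (\prod_(i <- r) k i) *: f x.
  have := H _ (enum_uniq 'I_n); rewrite big_enum /= => <-.
  by congr f; apply: eq_from_tnth => i; rewrite !tnth_mktuple mem_enum.
elim: r => [_|j r IHr] /=.
  by rewrite big_nil scale1r; congr f; apply: eq_from_tnth => i; rewrite tnth_mktuple.
case/andP=> /negbTE jr /IHr {}IHr; rewrite big_cons -scalerA -IHr.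
set y := [tuple if _ \in r then _ else _ | _ < n].
have -> : f y = f (set_tnth y j (tnth x j)).
  congr f; apply: eq_from_tnth => i; rewrite !tnth_mktuple.
  by case: eqP => [->|//]; rewrite jr.
rewrite -multilinear_setZ //; congr f; apply: eq_from_tnth => i.
by rewrite !tnth_mktuple in_cons; case: eqP => [->|].
Qed.

Lemma multilinear_head n (f : n.+1.-tuple V -> V) a y (x : n.-tuple V) :
  multilinear f -> f [tuple of a *: y :: x] = a *: f [tuple of y :: x].
Proof.
move=> f_lin; have E z : [tuple of z :: x] = set_tnth [tuple of y :: x] ord0 z.
  apply: eq_from_tnth => i; rewrite tnth_mktuple.
  by case: (unliftP ord0 i) => [j|] ->; rewrite ?tnth0 // !tnthS.
by rewrite (E (a *: y)) multilinear_setZ // -E.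
Qed.

Lemma multilinear_tail n (f : n.+1.-tuple V -> V) (k : 'I_n -> K) y (x : n.-tuple V) :
    multilinear f ->
  f [tuple of y :: [tuple k i *: tnth x i | i < n]] = (\prod_i k i) *: f [tuple of y :: x].
Proof.
move=> f_lin; pose k' (i : 'I_n.+1) := if unlift ord0 i is Some j then k j else 1.
have -> : \prod_i k i = \prod_i k' i.
  rewrite big_ord_recl /k' unlift_none mul1r.
  by apply: eq_bigr => j _; rewrite liftK.
rewrite -multilinear_scale //; congr f; apply: eq_from_tnth => i; rewrite tnth_mktuple /k'.
by case: unliftP => [j|] ->; rewrite ?tnth0 ?scale1r // !tnthS tnth_mktuple.
Qed.

End Multilinear.

Section Nesting.

Variables (K : fieldType) (V : lmodType K) (gr : int -> {pred V}).
Variable l : forall n, n.-tuple V -> V.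

(** The summand of the Jacobi expression at the identity unshuffle. *)
Definition nest n (p : 'I_n) (x : n.-tuple V) : V :=
  l [tuple of l (block1 p x) :: block2 p x].

Lemma jacobiE n (d : n.-tuple int) (x : n.-tuple V) :
  jacobi l d x =
  \sum_(p < n) (-1) ^+ (p.+1 * (n - p.+1))%N *:
    \sum_(s : 'S_n | unshuffle p.+1 s) chi K d s *: nest p (permute s x).
Proof.
apply: eq_bigr => p _; congr (_ *: _); apply: eq_bigr => s _; congr (_ *: _).
rewrite /nest; congr l; apply: eq_from_tnth => i.
case: (unliftP ord0 i) => [j|] ->; first by rewrite !tnthS !tnth_mktuple.
by rewrite !tnth0; congr l; apply: eq_mktuple => j; rewrite tnth_mktuple.
Qed.

Lemma homogeneous_permute n (d : n.-tuple int) (x : n.-tuple V) s :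
  homogeneous gr d x -> homogeneous gr (permute s d) (permute s x).
Proof. by move=> hx i; rewrite !tnth_mktuple. Qed.

Lemma homogeneous_block1 n (p : 'I_n) (d : n.-tuple int) (x : n.-tuple V) :
  homogeneous gr d x -> homogeneous gr (block1 p d) (block1 p x).
Proof. by move=> hx i; rewrite !tnth_mktuple. Qed.

Lemma homogeneous_block2 n (p : 'I_n) (d : n.-tuple int) (x : n.-tuple V) :
  homogeneous gr d x -> homogeneous gr (block2 p d) (block2 p x).
Proof. by move=> hx i; rewrite !tnth_mktuple. Qed.

Lemma skew_symmetric_tail n (f : n.+1.-tuple V -> V) d0 x0
    (d : n.-tuple int) (x : n.-tuple V) s :
    skew_symmetric gr f -> x0 \in gr d0 -> homogeneous gr d x ->
  f [tuple of x0 :: permute s x] = chi K d s *: f [tuple of x0 :: x].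
Proof.
move=> f_skew x0d xd.
rewrite -(chi_cons K d0 d s) -f_skew; last first.
  by move=> i; case: (unliftP ord0 i) => [j|] ->; rewrite ?tnth0 // !tnthS.
congr f; apply: eq_from_tnth => i; rewrite tnth_mktuple.
case: (unliftP ord0 i) => [j|] ->; first by rewrite lift_perm_lift !tnthS tnth_mktuple.
by rewrite lift_perm_id !tnth0.
Qed.

Hypothesis hlin : forall n, (1 <= n)%N -> multilinear (@l n).
Hypothesis hskew : forall n, (1 <= n)%N -> skew_symmetric gr (@l n).
Hypothesis hdeg : forall n, (1 <= n)%N -> has_degree gr (2 - n%:Z) (@l n).

(** A permutation that preserves both blocks acts on the inner and on the outer
    operation separately. *)
Lemma nest_skew n (p : 'I_n) (d : n.-tuple int) (x : n.-tuple V) h :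
    homogeneous gr d x -> h \in block_stab n p.+1 ->
  nest p (permute h x) = chi K d h *: nest p x.
Proof.
move=> xd /block_stabP hH.
have [h1 h1E] : exists h1 : 'S_p.+1, forall i, h (fst_block i) = fst_block (h1 i).
  apply: perm_restrict => [|i]; first exact: fst_block_inj.
  by rewrite codom_fst_block hH fst_block_lt.
have [h2 h2E] : exists h2 : 'S_(n - p.+1), forall j, h (snd_block j) = snd_block (h2 j).
  apply: perm_restrict => [|j]; first exact: snd_block_inj.
  by rewrite codom_snd_block leqNgt hH -leqNgt snd_block_ge.
have x1 := homogeneous_block1 (p := p) xd; have x2 := homogeneous_block2 (p := p) xd.
rewrite (chi_blocks K d h1E h2E) /nest.
have -> : block1 p (permute h x) = permute h1 (block1 p x).
  by apply: eq_from_tnth => i; rewrite !tnth_mktuple h1E.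
have -> : block2 p (permute h x) = permute h2 (block2 p x).
  by apply: eq_from_tnth => i; rewrite !tnth_mktuple h2E.
rewrite (hskew _ _ x1) // (multilinear_head _ _ _ (hlin _)) //.
by rewrite (skew_symmetric_tail _ (hskew _) (hdeg _ x1) x2) // scalerA.
Qed.

Lemma nest_scale n (p : 'I_n) (k : 'I_n -> K) (x : n.-tuple V) :
  nest p [tuple k i *: tnth x i | i < n] = (\prod_i k i) *: nest p x.
Proof.
have b1 : block1 p [tuple k i *: tnth x i | i < n]
    = [tuple k (fst_block i) *: tnth (block1 p x) i | i < p.+1].
  by apply: eq_mktuple => i; rewrite !tnth_mktuple.
have b2 : block2 p [tuple k i *: tnth x i | i < n]
    = [tuple k (snd_block j) *: tnth (block2 p x) j | j < n - p.+1].
  by apply: eq_mktuple => j; rewrite !tnth_mktuple.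
rewrite /nest b1 b2 (multilinear_scale _ _ (hlin (ltn0Sn p))).
rewrite (multilinear_head _ _ _ (hlin (ltn0Sn _))) (multilinear_tail _ _ _ (hlin (ltn0Sn _))).
by rewrite scalerA -big_blocks.
Qed.

Lemma jacobi_scale n (d : n.-tuple int) (k : 'I_n -> K) (x : n.-tuple V) :
  jacobi l d [tuple k i *: tnth x i | i < n] = (\prod_i k i) *: jacobi l d x.
Proof.
rewrite !jacobiE scaler_sumr; apply: eq_bigr => p _.
rewrite scaler_swap; congr (_ *: _); rewrite scaler_sumr; apply: eq_bigr => s _.
rewrite scaler_swap; congr (_ *: _).
have -> : permute s [tuple k i *: tnth x i | i < n]
    = [tuple k (s i) *: tnth (permute s x) i | i < n].
  by apply: eq_mktuple => i; rewrite !tnth_mktuple.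
by rewrite nest_scale [in RHS](reindex_inj (@perm_inj _ s)).
Qed.

Hypothesis charK : [pchar K] =i pred0.

Lemma natr_neq0 m : (0 < m)%N -> m%:R != 0 :> K.
Proof. by have /pcharf0P charK0 := charK; rewrite charK0 lt0n. Qed.

(** Averaged over the symmetric group, each inner sum of the Jacobi expression
    is skew symmetric by the cocycle rule for chi. *)
Lemma jacobi_permute n (t : 'S_n) (d : n.-tuple int) (x : n.-tuple V) :
    homogeneous gr d x ->
  jacobi l (permute t d) (permute t x) = chi K d t *: jacobi l d x.
Proof.
move=> xd; rewrite !jacobiE scaler_sumr; apply: eq_bigr => p _.
rewrite scaler_swap; congr (_ *: _).
have avg (d' : n.-tuple int) (x' : n.-tuple V) : homogeneous gr d' x' ->
    \sum_s chi K d' s *: nest p (permute s x') =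
    #|block_stab n p.+1|%:R *: \sum_(s | unshuffle p.+1 s) chi K d' s *: nest p (permute s x').
  move=> xd'; rewrite scaler_nat; apply: sum_unshuffle => h s hH.
  rewrite chiM -permuteM (nest_skew (homogeneous_permute s xd') hH) scalerA.
  by rewrite -mulrA chi_sq mulr1.
have stab_neq0 : #|block_stab n p.+1|%:R != 0 :> K.
  by apply: natr_neq0; apply/card_gt0P; exists 1%g; apply: block_stab1.
apply: (scalerI stab_neq0); rewrite scaler_swap -!avg //; last exact: homogeneous_permute.
rewrite scaler_sumr [RHS](reindex_inj (mulIg t)) /=; apply: eq_bigr => s _.
by rewrite permuteM scalerA chiM mulrA chi_sq mul1r.
Qed.

(** Exchanging two equal even entries changes the sign but not the arguments. *)
Lemma jacobi_repeat n (d : n.-tuple int) (x : n.-tuple V) i j :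
    homogeneous gr d x -> i != j -> tnth d i = 0 -> tnth d j = 0 ->
    tnth x i = tnth x j ->
  jacobi l d x = 0.
Proof.
move=> xd nij di dj xij; have := jacobi_permute (tperm i j) xd.
have inv T (y : n.-tuple T) : tnth y i = tnth y j -> permute (tperm i j) y = y.
  by move=> yij; apply: eq_from_tnth => k; rewrite tnth_mktuple; case: tpermP => [->|->|].
rewrite (inv _ d) ?di ?dj // (inv _ x) // chi_tperm // scaleN1r => /eqP.
rewrite -addr_eq0 -mulr2n -scaler_nat scaler_eq0 (negbTE (natr_neq0 _)) //.
by move/eqP.
Qed.

End Nesting.

(** * Degree tuples and their blocks *)

Section DegreeTuples.

Implicit Types n : nat.

Lemma count_tuple (T : Type) n (P : pred T) (d : n.-tuple T) :
  count P d = (\sum_(i < n) P (tnth d i))%N.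
Proof. by rewrite -sum1_count big_mkcond /= big_tuple; apply: eq_bigr => i _; case: (P _). Qed.

Lemma perm_blocks (T : eqType) n (p : 'I_n) (d : n.-tuple T) :
  perm_eq d (block1 p d ++ block2 p d).
Proof.
apply/seq.permP=> P; rewrite count_cat !count_tuple (big_blocks _ p) /=.
by congr (_ + _)%N; apply: eq_bigr => i _; rewrite tnth_mktuple.
Qed.

Lemma perm_permute (T : eqType) n (s : 'S_n) (d : n.-tuple T) : perm_eq (permute s d) d.
Proof. by apply/tuple_permP; exists s. Qed.

Lemma blocks_surj (T : Type) n (p : 'I_n) (d1 : p.+1.-tuple T) (d2 : (n - p.+1).-tuple T) :
  exists d : n.-tuple T, block1 p d = d1 /\ block2 p d = d2.
Proof.
exists (tcast (subnKC (ltn_ord p)) [tuple of d1 ++ d2]).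
split; apply: eq_from_tnth => i; rewrite tnth_mktuple tcastE.
  by rewrite -[RHS](tnth_lshift _ d2); congr tnth; apply: ord_inj.
by rewrite -[RHS](tnth_rshift d1); congr tnth; apply: ord_inj.
Qed.

Lemma count_mem_gt1 (T : eqType) n (d : n.-tuple T) z :
  (1 < count_mem z d)%N -> exists i j, [/\ i != j, tnth d i = z & tnth d j = z].
Proof.
have -> : count_mem z d = #|[pred i | tnth d i == z]|.
  rewrite count_tuple -sum1_card [RHS]big_mkcond.
  by apply: eq_bigr => i _; rewrite !inE; case: (_ == _).
by case/card_gt1P=> i [j [/eqP iz /eqP jz nij]]; exists i, j.
Qed.

Lemma unshuffle1 n p : unshuffle p (1 : 'S_n)%g.
Proof.
by apply/forallP=> i; apply/forallP=> j; apply/implyP=> /andP[lt_ij _]; rewrite !perm1.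
Qed.

End DegreeTuples.

(** Directness of the grading is applied to the vanishing sum of x in degree i
    and - x in degree j. *)
Lemma grading_disjoint (K : fieldType) (V : lmodType K) (gr : int -> {pred V}) i j x :
  is_grading gr -> x \in gr i -> x \in gr j -> i != j -> x = 0.
Proof.
case=> gr_sub _ gr_dir xi xj nij.
pose f z := if z == i then x else if z == j then - x else 0.
have fi : f i = x by rewrite /f eqxx.
have fj : f j = - x by rewrite /f eq_sym (negbTE nij) eqxx.
rewrite -fi; apply: (gr_dir [:: i; j]); rewrite ?mem_head //=.
- by rewrite inE nij.
- move=> z; rewrite /f; case: eqP => [->//|_]; have [gr0 grl] := gr_sub z.
  by case: eqP => [z_j|//]; rewrite -scaleN1r -[_ *: x]addr0 grl // z_j.
- by rewrite big_cons big_seq1 fi fj subrr.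
Qed.

(** * Values on basis tensors *)

Section ThreeDimensional.

Variables (K : fieldType) (V : lmodType K) (gr : int -> {pred V}).
Variables (u v w : V) (a b c : nat -> K) (l : forall n, n.-tuple V -> V).
Hypothesis charK : [pchar K] =i pred0.
Hypothesis hgr : is_grading gr.
Hypotheses (hu : u != 0) (hv : v != 0) (hw : w != 0).
Hypothesis hgru : forall x, x \in gr (-1) <-> exists k : K, x = k *: u.
Hypothesis hgrv : forall x, x \in gr 0 <-> exists k : K, x = k *: v.
Hypothesis hgrw : forall x, x \in gr 1 <-> exists k : K, x = k *: w.
Hypothesis hgr0 : forall i : int, i \notin [:: -1; 0; 1] -> forall x, x \in gr i <-> x = 0.
Hypothesis ha1 : a 1%N = 0.
Hypothesis hlin : forall n, (1 <= n)%N -> multilinear (@l n).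
Hypothesis hskew : forall n, (1 <= n)%N -> skew_symmetric gr (@l n).
Hypothesis hdeg : forall n, (1 <= n)%N -> has_degree gr (2 - n%:Z) (@l n).
Hypothesis hla : forall n, l [tuple of u :: v :: nseq n w] = a n.+2 *: u.
Hypothesis hlb : forall n, l [tuple of u :: nseq n w] = b n.+1 *: v.
Hypothesis hlc : forall n, l [tuple of v :: nseq n w] = c n.+1 *: w.
Hypothesis hl0 : forall n (x : n.-tuple V), (1 <= n)%N ->
  all [in [:: u; v; w]] x ->
  ~~ perm_eq x (u :: v :: nseq (n - 2) w) ->
  ~~ perm_eq x (u :: nseq (n - 1) w) ->
  ~~ perm_eq x (v :: nseq (n - 1) w) ->
  l x = 0.

Definition basis_vector (z : int) : V :=
  if z == -1 then u else if z == 0 then v else if z == 1 then w else 0.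

Definition basis_tuple n (d : n.-tuple int) : n.-tuple V :=
  [tuple of map basis_vector d].

Lemma basis_vector_gr z : basis_vector z \in gr z.
Proof.
rewrite /basis_vector; case: eqP => [->|z1]; first by apply/hgru; exists 1; rewrite scale1r.
case: eqP => [->|z2]; first by apply/hgrv; exists 1; rewrite scale1r.
case: eqP => [->|z3]; first by apply/hgrw; exists 1; rewrite scale1r.
by apply/hgr0 => //; rewrite !inE; do 3?[case: eqP => //].
Qed.

Lemma gr_basis_vector z x : x \in gr z -> exists k, x = k *: basis_vector z.
Proof.
rewrite /basis_vector; case: eqP => [->/hgru//|z1].
case: eqP => [->/hgrv//|z2]; case: eqP => [->/hgrw//|z3].
move/hgr0 => ->; first by exists 0; rewrite scaler0.
by rewrite !inE; do 3?[case: eqP => //].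
Qed.

Lemma homogeneous_basis n (d : n.-tuple int) : homogeneous gr d (basis_tuple d).
Proof. by move=> i; rewrite tnth_map basis_vector_gr. Qed.

Lemma homogeneous_scale n (d : n.-tuple int) x : homogeneous gr d x ->
  exists k : 'I_n -> K, x = [tuple k i *: tnth (basis_tuple d) i | i < n].
Proof.
move=> xd; have [k kE] := fin_all_exists (fun i => gr_basis_vector (xd i)).
by exists k; apply: eq_from_tnth => i; rewrite tnth_mktuple tnth_map kE.
Qed.

Lemma permute_basis n s (d : n.-tuple int) :
  permute s (basis_tuple d) = basis_tuple (permute s d).
Proof. by apply: eq_from_tnth => i; rewrite !(tnth_map, tnth_mktuple). Qed.

Lemma nest_basis n (p : 'I_n) (d : n.-tuple int) :
  nest l p (basis_tuple d) =
  l [tuple of l (basis_tuple (block1 p d)) :: basis_tuple (block2 p d)].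
Proof.
have E1 : block1 p (basis_tuple d) = basis_tuple (block1 p d).
  by apply: eq_from_tnth => i; rewrite !(tnth_map, tnth_mktuple).
have E2 : block2 p (basis_tuple d) = basis_tuple (block2 p d).
  by apply: eq_from_tnth => i; rewrite !(tnth_map, tnth_mktuple).
by rewrite /nest E1 E2.
Qed.

Lemma head_basis n (d : n.-tuple int) k z :
  l [tuple of k *: basis_vector z :: basis_tuple d]
  = k *: l (basis_tuple [tuple of z :: d]).
Proof.
rewrite multilinear_head; last exact: hlin.
by congr (_ *: l _); apply: val_inj.
Qed.

Lemma l_perm n (d d' : n.-tuple int) : (1 <= n)%N -> perm_eq d d' ->
  exists2 k : K, k != 0 & l (basis_tuple d) = k *: l (basis_tuple d').
Proof.
move=> n_gt0 /tuple_permP[s /val_inj->]; exists (chi K d' s); first exact: chi_neq0.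
by rewrite -hskew //; [rewrite permute_basis | exact: homogeneous_basis].
Qed.

Lemma odd_tnth n (d : n.-tuple int) :
  all (fun z : int => odd `|z|) d -> forall i, odd `|tnth d i|.
Proof. by move=> /all_tnthP. Qed.

Lemma l_perm_odd n (d d' : n.-tuple int) : (1 <= n)%N ->
    all (fun z : int => odd `|z|) d' -> perm_eq d d' ->
  l (basis_tuple d) = l (basis_tuple d').
Proof.
move=> n_gt0 /all_tnthP odd_d /tuple_permP[s /val_inj->].
rewrite -[RHS]scale1r -(chi_odd K s odd_d) -hskew //; last exact: homogeneous_basis.
by rewrite permute_basis.
Qed.

Lemma l_tail_perm_odd n z (d d' : n.-tuple int) :
    all (fun z : int => odd `|z|) d' -> perm_eq d d' ->
  l (basis_tuple [tuple of z :: d]) = l (basis_tuple [tuple of z :: d']).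
Proof.
move=> /all_tnthP odd_d /tuple_permP[s /val_inj->].
have := skew_symmetric_tail s (hskew (ltn0Sn n)) (basis_vector_gr z) (homogeneous_basis d').
rewrite chi_odd // scale1r permute_basis => tail_eq.
by rewrite -[LHS]scale1r -[RHS]scale1r -!head_basis scale1r.
Qed.

(** A left inverse of [basis_vector] on the three degrees, through which
    rearrangements of basis vectors become rearrangements of degrees. *)
Definition basis_degree (x : V) : int := if x == u then -1 else if x == v then 0 else 1.

Lemma basis_vectorK : {in [:: -1; 0; 1], cancel basis_vector basis_degree}.
Proof.
have dis i j x y : x \in gr i -> y \in gr j -> i != j -> y != 0 -> (y == x) = false.
  move=> xi yj nij ny; apply/eqP=> eyx; case/eqP: ny.
  by apply: (grading_disjoint hgr _ yj nij); rewrite eyx.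
have [gu gv gw] := And3 (basis_vector_gr (-1)) (basis_vector_gr 0) (basis_vector_gr 1).
move=> z; rewrite !inE /basis_degree => /or3P[]/eqP->; rewrite /basis_vector /= ?eqxx //.
- by rewrite (dis _ _ _ _ gu gv) ?eqxx.
- by rewrite (dis _ _ _ _ gu gw) // (dis _ _ _ _ gv gw).
Qed.

Lemma l_support n (d : n.-tuple int) : (1 <= n)%N -> l (basis_tuple d) != 0 ->
  [\/ perm_eq d (-1 :: 0 :: nseq (n - 2) 1), perm_eq d (-1 :: nseq (n - 1) 1)
    | perm_eq d (0 :: nseq (n - 1) 1)].
Proof.
move=> n_gt0 nz_l; have d_in : all [in [:: -1; 0; 1]] d.
  apply/all_tnthP=> i; apply/negPn/negP=> d_i; case/eqP: nz_l.
  have e0 : basis_vector (tnth d i) = 0.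
    by have := basis_vector_gr (tnth d i); move/(hgr0 d_i).
  rewrite -(multilinear_set0 (basis_tuple d) i (hlin n_gt0)); congr l.
  by apply: eq_from_tnth => j; rewrite [RHS]tnth_mktuple; case: eqP => // ->; rewrite tnth_map.
have dK : map basis_degree (basis_tuple d) = d.
  by rewrite -map_comp -[RHS]map_id; apply/eq_in_map => z zd; apply/basis_vectorK/(allP d_in).
have perm_d t : all [in [:: -1; 0; 1]] t ->
    perm_eq (basis_tuple d) (map basis_vector t) -> perm_eq d t.
  move=> t_in /(perm_map basis_degree); rewrite dK -map_comp map_id_in //.
  by move=> z zt; apply/basis_vectorK/(allP t_in).
have nseq_in k : all [in [:: -1; 0; 1]] (nseq k (1 : int)) by rewrite all_nseq orbT.
have [|pA] := boolP (perm_eq (basis_tuple d) (u :: v :: nseq (n - 2) w)).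
  by move=> pA; apply: Or31; apply: perm_d; rewrite /= ?nseq_in // map_nseq.
have [|pB] := boolP (perm_eq (basis_tuple d) (u :: nseq (n - 1) w)).
  by move=> pB; apply: Or32; apply: perm_d; rewrite /= ?nseq_in // map_nseq.
have [|pC] := boolP (perm_eq (basis_tuple d) (v :: nseq (n - 1) w)).
  by move=> pC; apply: Or33; apply: perm_d; rewrite /= ?nseq_in // map_nseq.
case/eqP: nz_l; apply: hl0 => //; apply/all_tnthP=> i; rewrite tnth_map.
have := all_tnthP d_in i; rewrite !inE /basis_vector.
by case/or3P=> /eqP-> /=; rewrite eqxx ?orbT.
Qed.

Lemma l_perm_a n (d : n.-tuple int) : perm_eq d (-1 :: 0 :: nseq (n - 2) 1) ->
  exists2 k : K, k != 0 & l (basis_tuple d) = k *: (a n *: u).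
Proof.
case: n d => [|[|n]] d pd; do 1?[by move/perm_size: pd; rewrite size_tuple].
have [||k k_neq0 ->] := @l_perm _ d [tuple of -1 :: 0 :: nseq n 1] => //.
  by move: pd; rewrite subSS subn1.
exists k => //; rewrite -hla; congr (_ *: l _); apply: val_inj => /=.
by rewrite map_nseq.
Qed.

Lemma l_perm_b n (d : n.-tuple int) : perm_eq d (-1 :: nseq (n - 1) 1) ->
  l (basis_tuple d) = b n *: v.
Proof.
case: n d => [|n] d pd; first by move/perm_size: pd; rewrite size_tuple.
rewrite (@l_perm_odd _ d [tuple of -1 :: nseq n 1]) //.
- by rewrite -hlb; congr l; apply: val_inj; rewrite /= map_nseq.
- by rewrite /= all_nseq orbT.
- by move: pd; rewrite subn1.
Qed.

Lemma l_perm_c n (d : n.-tuple int) : perm_eq d (0 :: nseq (n - 1) 1) ->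
  exists2 k : K, k != 0 & l (basis_tuple d) = k *: (c n *: w).
Proof.
case: n d => [|n] d pd; first by move/perm_size: pd; rewrite size_tuple.
have [||k k_neq0 ->] := @l_perm _ d [tuple of 0 :: nseq n 1] => //.
  by move: pd; rewrite subn1.
exists k => //; rewrite -hlc; congr (_ *: l _); apply: val_inj => /=.
by rewrite map_nseq.
Qed.

(** On tensors with an even entry the constants a and c govern the operation;
    only the parity of its value matters for composites. *)
Lemma l_even n (d : n.-tuple int) : (1 <= n)%N -> 0 \in d ->
  exists k z, [/\ l (basis_tuple d) = k *: basis_vector z, z != 0
    & a n = 0 /\ c n = 0 -> k = 0].
Proof.
move=> n_gt0 d0; have [->|nz_l] := eqVneq (l (basis_tuple d)) 0.
  by exists 0, 1; rewrite scale0r.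
case: (l_support n_gt0 nz_l) => [/l_perm_a[k _ ->]|pd|/l_perm_c[k _ ->]].
- exists (k * a n), (-1); split=> // [|[-> _]]; by rewrite ?scalerA ?mulr0.
- by move: d0; rewrite (perm_mem pd) inE mem_nseq andbF.
- exists (k * c n), 1; split=> // [|[_ ->]]; by rewrite ?scalerA ?mulr0.
Qed.

Lemma l_odd n (d : n.-tuple int) : (1 <= n)%N -> 0 \notin d ->
  exists k, l (basis_tuple d) = k *: basis_vector 0 /\ (b n = 0 -> k = 0).
Proof.
move=> n_gt0 d0; have [->|nz_l] := eqVneq (l (basis_tuple d)) 0.
  by exists 0; rewrite scale0r.
case: (l_support n_gt0 nz_l) => [pd|/l_perm_b->|pd].
- by move: d0; rewrite (perm_mem pd) !inE eqxx.
- by exists (b n).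
- by move: d0; rewrite (perm_mem pd) !inE eqxx.
Qed.

(** If the inner operation takes the even entry, then its value is odd and the
    outer operation has odd entries only; if it does not, then its value is even
    and the outer operation takes it. Either way one factor is governed by b and
    the other one by a or c. *)
Lemma nest_eq0 n (p : 'I_n) (d : n.-tuple int) (q := (n - p.+1).+1) :
    (count_mem (0 : int) d <= 1)%N ->
    b p.+1 = 0 \/ (a q = 0 /\ c q = 0) ->
    b q = 0 \/ (a p.+1 = 0 /\ c p.+1 = 0) ->
  nest l p (basis_tuple d) = 0.
Proof.
move=> d_le1 bp bq; rewrite nest_basis.
have [d1|d1] := boolP (0 \in block1 p d).
  have d2 : 0 \notin block2 p d.
    move: d_le1; rewrite (seq.permP (perm_blocks p d)) count_cat.
    move: d1; rewrite -!has_pred1 !has_count.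
    by case: (count _ _) => // k _; rewrite addSn ltnS leqn0 addn_eq0 => /andP[_ /eqP->].
  have [k [z [-> z0 k0]]] := l_even (ltn0Sn p) d1; rewrite head_basis.
  have [|k' [-> k'0]] := @l_odd _ [tuple of z :: block2 p d] (ltn0Sn _).
    by rewrite inE negb_or eq_sym z0.
  by case: bq => [/k'0->|/k0->]; rewrite scale0r ?scaler0.
have [k [-> k0]] := l_odd (ltn0Sn p) d1; rewrite head_basis.
have [|k' [z [-> _ k'0]]] := @l_even _ [tuple of 0 :: block2 p d] (ltn0Sn _).
  by rewrite inE eqxx.
by case: bp => [/k0->|/k'0->]; rewrite scale0r ?scaler0.
Qed.

(** Homogeneous vectors are multiples of basis vectors, so basis tensors suffice;
    two entries v are dealt with by skew symmetry, the others term by term. *)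
Lemma jacobi_eq0 n (d : n.-tuple int) x : homogeneous gr d x ->
    (forall p q, (1 <= p)%N -> (1 <= q)%N -> (p + q)%N = n.+1 ->
       b p = 0 \/ (a q = 0 /\ c q = 0)) ->
  jacobi l d x = 0.
Proof.
move=> /homogeneous_scale[k ->] bac; rewrite jacobi_scale //.
have [/count_mem_gt1[i [j [nij di dj]]]|d_le1] := ltnP 1 (count_mem (0 : int) d).
  rewrite (jacobi_repeat hlin hskew hdeg charK (homogeneous_basis d) nij di dj) ?scaler0 //.
  by rewrite !tnth_map di dj.
suff -> : jacobi l d (basis_tuple d) = 0 by rewrite scaler0.
rewrite jacobiE big1 // => p _; rewrite big1 ?scaler0 // => s _.
rewrite permute_basis nest_eq0 ?scaler0 //.
- by rewrite (seq.permP (perm_permute s d)).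
- by apply: bac => //; have := ltn_ord p; lia.
- by apply: bac => //; have := ltn_ord p; lia.
Qed.

(** A nonzero inner operation on odd entries has exactly one u among them. This
    fixes the first block up to order, hence also the second one, and odd
    entries may be reordered freely. *)
Lemma nest_odd_perm n (p : 'I_n) (d : n.-tuple int) s :
    all (fun z : int => odd `|z|) d ->
    perm_eq (block1 p d) (-1 :: nseq p 1) ->
  nest l p (basis_tuple (permute s d)) = 0 \/
  nest l p (basis_tuple (permute s d)) = nest l p (basis_tuple d).
Proof.
move=> odd_d d1; have pd := perm_permute s d; set d' := permute s d in pd *.
have odd_blocks (t : n.-tuple int) : perm_eq t d ->
    all (fun z : int => odd `|z|) (block1 p t) /\ all (fun z : int => odd `|z|) (block2 p t).
  move=> td; apply/andP; rewrite -all_cat -(perm_all _ (perm_blocks p t)).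
  by rewrite (perm_all _ td).
have [odd1 odd2] := odd_blocks d (perm_refl _).
have [odd1' odd2'] := odd_blocks d' pd.
rewrite !nest_basis.
have [l0|nz_l] := eqVneq (l (basis_tuple (block1 p d'))) 0.
  by left; rewrite l0; have := head_basis (block2 p d') 0 0; rewrite !scale0r.
right; have no0 : 0 \notin block1 p d' by apply/negP=> /(allP odd1').
have d1' : perm_eq (block1 p d') (block1 p d).
  rewrite (permPr d1).
  case: (l_support (ltn0Sn p) nz_l) => p1; last 2 first.
  - by rewrite subn1 in p1.
  - by rewrite (perm_mem p1) inE eqxx in no0.
  - by rewrite (perm_mem p1) !inE eqxx orbT in no0.
have d2' : perm_eq (block2 p d') (block2 p d).
  rewrite -(perm_cat2l (block1 p d)) -(permPr (perm_blocks p d)) perm_sym -(permPl pd).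
  by rewrite (permPl (perm_blocks p d')) perm_cat2r.
rewrite (l_perm_odd (ltn0Sn p) odd1 d1') l_perm_b ?subn1 //.
by rewrite -[v]/(basis_vector 0) !head_basis (l_tail_perm_odd 0 odd2 d2').
Qed.

(** The Jacobi expression is evaluated on u, w, ..., w followed by d2. Inner
    operations of arity less than p.+1 vanish because of b, outer operations
    paired with an inner arity greater than p.+1 because of a and c. What
    remains is a positive multiple of the summand at the identity, and it
    contains the nonzero factor b p.+1. *)
Lemma jacobi_leading_term n (p : 'I_n) (d2 : (n - p.+1).-tuple int) :
    all (fun z : int => odd `|z|) d2 ->
    (forall d : n.-tuple int, jacobi l d (basis_tuple d) = 0) ->
    (forall q, (1 <= q < p.+1)%N -> b q = 0) -> b p.+1 != 0 ->
    (forall q, (1 <= q <= n - p.+1)%N -> a q = 0 /\ c q = 0) ->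
  l (basis_tuple [tuple of 0 :: d2]) = 0.
Proof.
move=> odd_d2 jac0 b_lt b_neq0 ac_lt.
have [d [d1E d2E]] := blocks_surj [tuple of -1 :: nseq p (1 : int)] d2.
have d1_perm : perm_eq (block1 p d) (-1 :: nseq p 1) by rewrite d1E.
have odd_d : all (fun z : int => odd `|z|) d.
  rewrite (perm_all _ (perm_blocks p d)) all_cat d1E d2E odd_d2 andbT /=.
  by rewrite all_nseq orbT.
suff : nest l p (basis_tuple d) = 0.
  rewrite nest_basis l_perm_b ?subn1 // -[v]/(basis_vector 0) head_basis d2E.
  by move/eqP; rewrite scaler_eq0 (negbTE b_neq0) => /eqP.
have := jac0 d; rewrite jacobiE (bigD1 p) //= [X in _ + X]big1 ?addr0 => [|r nrp]; last first.
  rewrite big1 ?scaler0 // => s _; rewrite permute_basis nest_basis.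
  have [|k [-> k0]] := @l_odd _ (block1 r (permute s d)) (ltn0Sn r).
    apply/negP=> d0; suff /(allP odd_d) : 0 \in d by [].
    by rewrite -(perm_mem (perm_permute s d)) (perm_mem (perm_blocks r _)) mem_cat d0.
  rewrite head_basis; case: (ltngtP r p) nrp =>
    [lt_rp|lt_pr|/ord_inj->] => [_|_|]; last by rewrite eqxx.
    by rewrite k0 ?scale0r ?scaler0 // b_lt // ltnS.
  have [|k' [z [-> _ ->]]] := @l_even _ [tuple of 0 :: block2 r (permute s d)] (ltn0Sn _).
  - by rewrite inE eqxx.
  - by rewrite scale0r !scaler0.
  - by apply: ac_lt; have := ltn_ord r; lia.
move/eqP; rewrite scaler_eq0 signr_eq0 /= => /eqP.
(* All signs chi are 1, so the sum counts the nonzero summands; the identity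
   unshuffle contributes one of them. *)
rewrite (eq_bigr (fun s => if nest l p (basis_tuple (permute s d)) == 0 then 0
    else nest l p (basis_tuple d))) => [|s _]; last first.
  rewrite chi_odd ?scale1r ?permute_basis; last exact: odd_tnth.
  by case: eqP => // nz; case: (nest_odd_perm s odd_d d1_perm).
have [//|nz] := eqVneq (nest l p (basis_tuple d)) 0.
under eq_bigr do rewrite -if_neg.
rewrite -big_mkcondr /= sumr_const -scaler_nat => /eqP.
rewrite scaler_eq0 (negbTE nz) orbF (negbTE (natr_neq0 charK _)) //.
by apply/card_gt0P; exists 1%g; rewrite unfold_in /= unshuffle1 permute1 nz.
Qed.

(** The second block is chosen as w, ..., w to reach c and as u, w, ..., w to
    reach a; for an empty second block a 1 = 0 is given. *)
Lemma ac_eq0 n (p : 'I_n) :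
    (forall d : n.-tuple int, jacobi l d (basis_tuple d) = 0) ->
    (forall q, (1 <= q < p.+1)%N -> b q = 0) -> b p.+1 != 0 ->
    (forall q, (1 <= q <= n - p.+1)%N -> a q = 0 /\ c q = 0) ->
  a (n - p.+1).+1 = 0 /\ c (n - p.+1).+1 = 0.
Proof.
move=> jac0 b_lt b_neq0 ac_lt.
have lead d2 odd_d2 := @jacobi_leading_term n p d2 odd_d2 jac0 b_lt b_neq0 ac_lt.
move: lead; move: (n - p.+1)%N => r lead; split.
  case: r lead => [|r] lead; first exact: ha1.
  have := lead [tuple of -1 :: nseq r (1 : int)]; rewrite /= all_nseq orbT => /(_ isT).
  have [|k k_neq0 ->] := @l_perm_a _ [tuple of 0 :: -1 :: nseq r (1 : int)].
    by rewrite subSS subn1 /= -[X in perm_eq X _]/([:: 0] ++ [:: -1] ++ nseq r 1) perm_catCA.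
  by move/eqP; rewrite !scaler_eq0 (negbTE k_neq0) (negbTE hu) orbF => /eqP.
have := lead (nseq_tuple r 1); rewrite all_nseq orbT => /(_ isT).
have [|k k_neq0 ->] := @l_perm_c _ [tuple of 0 :: nseq_tuple r (1 : int)].
  by rewrite subn1.
by move/eqP; rewrite !scaler_eq0 (negbTE k_neq0) (negbTE hw) orbF => /eqP.
Qed.

End ThreeDimensional.

Theorem theorem4p7 (K : fieldType) (charK : [pchar K] =i pred0)
    (V : lmodType K) (gr : int -> {pred V}) (hgr : is_grading gr)
    (u v w : V) (hu : u != 0) (hv : v != 0) (hw : w != 0)
    (hgru : forall x, x \in gr (-1) <-> exists k : K, x = k *: u)
    (hgrv : forall x, x \in gr 0 <-> exists k : K, x = k *: v)
    (hgrw : forall x, x \in gr 1 <-> exists k : K, x = k *: w)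
    (hgr0 : forall i : int, i \notin [:: -1; 0; 1] ->
       forall x, x \in gr i <-> x = 0)
    (a b c : nat -> K) (ha1 : a 1%N = 0)
    (l : forall n, n.-tuple V -> V)
    (hlin : forall n, (1 <= n)%N -> multilinear (l n))
    (hskew : forall n, (1 <= n)%N -> skew_symmetric gr (l n))
    (hdeg : forall n, (1 <= n)%N -> has_degree gr (2 - n%:Z) (l n))
    (hla : forall n, l n.+2 [tuple of u :: v :: nseq n w] = a n.+2 *: u)
    (hlb : forall n, l n.+1 [tuple of u :: nseq n w] = b n.+1 *: v)
    (hlc : forall n, l n.+1 [tuple of v :: nseq n w] = c n.+1 *: w)
    (hl0 : forall n (x : n.-tuple V), (1 <= n)%N ->
       all [in [:: u; v; w]] x ->
       ~~ perm_eq x (u :: v :: nseq (n - 2) w) ->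
       ~~ perm_eq x (u :: nseq (n - 1) w) ->
       ~~ perm_eq x (v :: nseq (n - 1) w) ->
       l n x = 0)
    (m : nat) (hm : (1 <= m)%N) :
  L_structure gr l m <->
    (forall p, (1 <= p <= m)%N -> b p = 0) \/
    (exists k : nat,
      [/\ (1 <= k <= m)%N,
          forall p, (1 <= p < k)%N -> b p = 0,
          b k != 0
        & forall q, (1 <= q <= m - k + 1)%N -> a q = 0 /\ c q = 0]).
Proof.
have basisP := homogeneous_basis hgru hgrv hgrw hgr0.
split=> [[_ jac0]|bac]; last first.
  split=> [k /andP[k_gt0 _]|n /andP[_ le_nm] d x xd].
    by split; [exact: hlin | exact: hskew | exact: hdeg].
  apply: (jacobi_eq0 charK hgr hu hv hw hgru hgrv hgrw hgr0
    hlin hskew hdeg hla hlb hlc hl0 xd)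
    => p q p_gt0 q_gt0 pq.
  case: bac => [b0|[k [/andP[k_gt0 le_km] b_lt b_neq0 ac0]]].
    by left; apply: b0; lia.
  have [lt_pk|le_kp] := ltnP p k; first by left; apply: b_lt; lia.
  by right; apply: ac0; lia.
have jac_basis n : (1 <= n <= m)%N -> forall d : n.-tuple int,
    jacobi l d (basis_tuple u v w d) = 0.
  by move=> n_m d; apply: jac0.
have [b0|] := boolP [forall p : 'I_m, b p.+1 == 0].
  left=> p /andP[p_gt0 le_pm]; case: p p_gt0 le_pm => // p _ lt_pm.
  by have /forallP/(_ (Ordinal lt_pm))/eqP := b0.
rewrite negb_forall => /existsP[p0 bp0].
have ex_b : exists k, (0 < k)%N && (b k != 0) by exists p0.+1.
case: (ex_minnP ex_b) => k /andP[k_gt0 bk] min_k.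
have le_km : (k <= m)%N by apply: leq_trans (min_k p0.+1 _) (ltn_ord p0).
have b_lt q : (1 <= q < k)%N -> b q = 0.
  case/andP=> q_gt0 lt_qk; apply/eqP/negPn/negP=> bq.
  by have := min_k q; rewrite q_gt0 bq leqNgt lt_qk => /(_ isT).
right; exists k; split=> //; first by rewrite k_gt0.
(* Induction on q: the arity of the Jacobi expression is k + q - 1, which reads
   k + q once k is replaced by its successor. *)
elim/ltn_ind=> q IHq /andP[q_gt0 le_q].
case: k k_gt0 bk min_k le_km b_lt le_q IHq => // k _ bk _ lt_km b_lt le_q IHq.
have lt_k : (k < k + q)%N by lia.
have qE : (k + q - k.+1).+1 = q by lia.
have := @ac_eq0 _ _ gr u v w a b c l charK hgr hu hv hw hgru hgrv hgrw hgr0 ha1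
  hlin hskew hla hlb hlc hl0 _ (Ordinal lt_k).
rewrite /= qE; apply=> //; first by apply: jac_basis; lia.
by move=> r r_q; apply: IHq; lia.
Qed.
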